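(* Let $\mathcal{R}=(Sen,Mod,\models)$ be a satisfaction system, $T$ a knowledge base, $\mathcal{C}$ a set of cuttings for $T$, and $\rhd_{\mathcal{C}}$ the explanatory relation based on $\mathcal{C}$. The following hold for all $\varphi,\varphi',\psi,\psi'\in Sen$: (1) Assume that $\mathcal{C}$ satisfies: for all formulas $\alpha,\alpha'$, if $\alpha\equiv_T\alpha'$ then $\mathcal{C}_\alpha=\mathcal{C}_{\alpha'}$. If $\varphi\equiv_T\varphi'$, $\psi\equiv_T\psi'$ and $\varphi\rhd_{\mathcal{C}}\psi$, then $\varphi'\rhd_{\mathcal{C}}\psi'$. (2) If $\varphi\rhd_{\mathcal{C}}\psi$ and $T\cup\{\psi'\}\models\psi$ with $Mod(T\cup\{\psi'\})\neq Triv$, then $\varphi\rhd_{\mathcal{C}}\psi'$. (3) For $\varphi$ consistent with $T$: $\psi\in Expla_T(\varphi)$ if and only if there exists a relation $\rhd_{\mathcal{C}'}$ based on some set of cuttings $\mathcal{C}'$ for $T$ such that $\varphi\rhd_{\mathcal{C}'}\psi$. (4) If $\mathcal{R}$ is finitely axiomatizable (every $\mathbb{M}\subseteq Mod$ is finitely axiomatizable) and has conjunction, then for every cutting $\mathcal{C}_\varphi$ for $T$ and $\varphi$ we have $Expla_T(\varphi)\neq\emptyset$ and there exists $\psi\in Sen$ such that $\varphi\rhd_{\mathcal{C}'}\psi$, where $\rhd_{\mathcal{C}'}$ is a relation based on a set of cuttings $\mathcal{C}'$ for $T$ whose cutting associated with $\varphi$ is $\mathcal{C}_\varphi$.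
   Context: A satisfaction system $\mathcal{R}=(Sen,Mod,\models)$ consists of a set $Sen$ of sentences (formulas), a class $Mod$ of models, and a relation $\models\,\subseteq Mod\times Sen$. For $T\subseteq Sen$, $Mod(T)=\{\mathcal{M}\in Mod\mid \forall\varphi\in T,\ \mathcal{M}\models\varphi\}$ and $Mod(\varphi)=Mod(\{\varphi\})$. $T\models\varphi$ means that every model in $Mod(T)$ satisfies $\varphi$. $\varphi\equiv_T\psi$ means $Mod(T\cup\{\varphi\})=Mod(T\cup\{\psi\})$. $Triv=\{\mathcal{M}\in Mod\mid \forall\varphi\in Sen,\ \mathcal{M}\models\varphi\}$. A set of sentences $T$ is consistent iff $Mod(T)\neq Triv$; $\varphi$ is consistent with $T$ iff $T\cup\{\varphi\}$ is consistent. A knowledge base (KB) is a finite set of sentences. A class $\mathbb{M}\subseteq Mod$ is finitely axiomatizable if there is a finite KB $T'$ with $Mod(T')=\mathbb{M}$. $\mathcal{R}$ has conjunction if for any $\varphi_1,\varphi_2\in Sen$ there is a sentence $\varphi_1\wedge\varphi_2$ with $Mod(\varphi_1\wedge\varphi_2)=Mod(\varphi_1)\cap Mod(\varphi_2)$. Explanations: for $\varphi$ consistent with $T$, $Expla_T(\varphi)=\{\psi\in Sen\mid Mod(T\cup\{\psi\})\neq Triv\text{ and }T\cup\{\psi\}\models\varphi\}$. Cutting: a cutting for a KB $T$ and a formula $\varphi$ is a set $\mathcal{C}_\varphi\subseteq\mathcal{P}(Mod(T\cup\{\varphi\}))$ such that: $Triv\subsetneq\mathbb{M}$ for every $\mathbb{M}\in\mathcal{C}_\varphi$;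 $\mathcal{C}_\varphi$ is closed under set-theoretical union (of non-empty subfamilies); $Mod(T\cup\{\varphi\})\in\mathcal{C}_\varphi$; and the poset $(\mathcal{C}_\varphi,\subseteq)$ is well-founded (every non-empty subset has a minimal element). $Min(\mathcal{C}_\varphi)$ denotes the set of $\subseteq$-minimal elements of $\mathcal{C}_\varphi$. Set of cuttings and explanatory relation: a set of cuttings $\mathcal{C}$ for $T$ is obtained by choosing, for each formula $\varphi$ with $Mod(T\cup\{\varphi\})\neq Triv$, one cutting $\mathcal{C}_\varphi$ for $T$ and $\varphi$. The explanatory relation $\rhd_{\mathcal{C}}\subseteq Sen\times Sen$ based on $\mathcal{C}$ is defined by: $\varphi\rhd_{\mathcal{C}}\psi$ iff $Mod(T\cup\{\psi\})\neq Triv$ and there exists $\mathbb{M}\in Min(\mathcal{C}_\varphi)$ with $Mod(T\cup\{\psi\})\subseteq\mathbb{M}$ (so $\varphi\rhd_{\mathcal{C}}\psi$ holds for no $\psi$ when $Mod(T\cup\{\varphi\})=Triv$). *)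

(* Defs.v *)
From mathcomp Require Import all_boot.
From mathcomp Require Export classical_sets cardinality.

Set Implicit Arguments.
Unset Strict Implicit.
Unset Printing Implicit Defensive.

Local Open Scope classical_set_scope.

Record satisfaction_system := SatisfactionSystem {
  Sen : Type;
  Mod : Type;
  sat : Mod -> Sen -> Prop
}.

Section SatisfactionSystem.
Variable R : satisfaction_system.
Implicit Types (T : set (Sen R)) (phi psi : Sen R) (A B : set (Mod R)).

Definition models T : set (Mod R) :=
  [set m | forall phi, T phi -> sat m phi].

Definition add_sentence T phi : set (Sen R) := T `|` [set phi].

Definition entails T phi : Prop := forall m, models T m -> sat m phi.

Definition equiv_mod T phi psi : Prop :=
  models (add_sentence T phi) = models (add_sentence T psi).

Definition triv : set (Mod R) := [set m | forall phi, sat m phi].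

Definition consistent T : Prop := models T <> triv.

Definition consistent_with T phi : Prop := consistent (add_sentence T phi).

Definition knowledge_base T : Prop := finite_set T.

Definition finitely_axiomatizable_class A : Prop :=
  exists T, knowledge_base T /\ models T = A.

Definition finitely_axiomatizable : Prop :=
  forall A, finitely_axiomatizable_class A.

Definition has_conjunction : Prop :=
  forall phi1 phi2, exists phi,
    models [set phi] = models [set phi1] `&` models [set phi2].

Definition explanations T phi : set (Sen R) :=
  [set psi | consistent_with T psi /\ entails (add_sentence T psi) phi].

Definition minimal_elements (F : set (set (Mod R))) : set (set (Mod R)) :=
  [set A | F A /\ forall B, F B -> B `<=` A -> B = A].

Record is_cutting T phi (K : set (set (Mod R))) : Prop := IsCutting {
  cutting_sub : forall A, K A -> A `<=` models (add_sentence T phi);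
  cutting_triv : forall A, K A -> triv `<` A;
  cutting_union : forall F : set (set (Mod R)),
    F `<=` K -> F !=set0 -> K (\bigcup_(A in F) A);
  cutting_top : K (models (add_sentence T phi));
  cutting_wf : forall F : set (set (Mod R)),
    F `<=` K -> F !=set0 -> minimal_elements F !=set0
}.

(* A choice of cuttings is a partial map, defined on the sentences consistent
   with T.  It is encoded as a total map equal to set0 off that domain; set0 is
   never a cutting, and it has no minimal element, so that [explains] below
   relates a sentence inconsistent with T to no sentence. *)
Definition set_of_cuttings T (C : Sen R -> set (set (Mod R))) : Prop :=
  forall phi,
    (consistent_with T phi -> is_cutting T phi (C phi)) /\
    (~ consistent_with T phi -> C phi = set0).

Definition explains T (C : Sen R -> set (set (Mod R))) phi psi : Prop :=
  consistent_with T psi /\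
  exists A, minimal_elements (C phi) A /\ models (add_sentence T psi) `<=` A.

End SatisfactionSystem.

(* Main.v *)
(* The one-element family {Mod(T + phi)} is always a cutting, and any cutting for
   phi extends to a set of cuttings by using these families at the other
   sentences.  For (4), well-foundedness gives a minimal class A of the cutting;
   a finite axiomatization of A, conjoined with phi, is a single sentence whose
   models over T are exactly A. *)
Require Import Defs.
From mathcomp Require Import all_boot boolp classical_sets cardinality.

Local Open Scope classical_set_scope.

Lemma models_add_sentence (R : satisfaction_system) (T : set (Sen R))
    (phi : Sen R) (m : Mod R) :
  models (add_sentence T phi) m <-> models T m /\ sat m phi.
Proof.
split=> [mTphi|[mT mphi] alpha [|->]//]; last exact: mT.
by split=> [alpha Talpha|]; apply: mTphi; [left|right].
Qed.

Lemma models_set1 (R : satisfaction_system) (phi : Sen R) (m : Mod R) :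
  models [set phi] m <-> sat m phi.
Proof. by split=> [|mphi _ ->]; first by apply. Qed.

(** Induction on a list enumerating [U], conjoining its sentences one by one onto [phi]. Starting
    from [phi] covers the empty list, where binary conjunction alone supplies no valid sentence. *)
Lemma models_conjunction (R : satisfaction_system) (U : set (Sen R))
    (phi : Sen R) :
  has_conjunction R -> finite_set U ->
  exists chi, models [set chi] = models (add_sentence U phi).
Proof.
(* [classic] gives the bare type of sentences the decidable equality that list membership
   requires. *)
move=> conj /(@finite_seqP {classic Sen R})[s ->] {U}.
elim: s => [|alpha s [chi chiE]].
  exists phi; congr models; apply/seteqP.
  by split=> [beta ->|beta [|]//]; right.
have [chi' chi'E] := conj alpha chi; exists chi'.
rewrite chi'E chiE; apply/seteqP; split=> m.
  move=> [/models_set1 malpha /models_add_sentence[ms mphi]].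
  apply/models_add_sentence; split=> // beta /=.
  by rewrite in_cons => /orP[/eqP ->//|]; apply: ms.
move=> /models_add_sentence[ms mphi]; split.
  by apply/models_set1; apply: ms => /=; apply: mem_head.
apply/models_add_sentence; split=> // beta sbeta; apply: ms => /=.
by rewrite in_cons sbeta orbT.
Qed.

(** Consistency makes the inclusion of [triv] strict; a nonempty subfamily of a singleton is that
    singleton, which settles unions and minimality. *)
Lemma is_cutting_set1 (R : satisfaction_system) (T : set (Sen R))
    (phi : Sen R) :
  consistent_with T phi ->
  is_cutting T phi [set models (add_sentence T phi)].
Proof.
move=> cphi; have trivS : triv (R:=R) `<=` models (add_sentence T phi).
  by move=> m mtriv alpha _; apply: mtriv.
split=> // [A -> //|A ->|F FK [A FA]|F FK [A FA]].
- by rewrite properEneq; split=> //; apply/eqP => /esym.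
- apply/seteqP; split=> [m [B /FK -> //]|m mphi].
  by exists A => //; rewrite (FK _ FA).
- by exists A; split=> // B /FK -> _; rewrite (FK _ FA).
Qed.

(** The top class of a cutting strictly contains [triv]. Hence placing [K] at [phi] never conflicts
    with the value [set0] imposed at inconsistent sentences. *)
Lemma is_cutting_consistent (R : satisfaction_system) (T : set (Sen R))
    (phi : Sen R) (K : set (set (Mod R))) :
  is_cutting T phi K -> consistent_with T phi.
Proof.
move=> cutK phitriv.
have := cutting_triv cutK (cutting_top cutK).
by rewrite phitriv => /properxx.
Qed.

Lemma set_of_cuttings_extend (R : satisfaction_system) (T : set (Sen R))
    (phi : Sen R) (K : set (set (Mod R))) :
  is_cutting T phi K -> exists C, set_of_cuttings T C /\ C phi = K.
Proof.
move=> cutK.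
exists (fun alpha => if pselect (alpha = phi) then K else
  if pselect (consistent_with T alpha)
  then [set models (add_sentence T alpha)] else set0).
split=> [alpha|]; last by case: pselect.
case: pselect => [/= ->|_] /=.
  by split=> // ncphi; case: ncphi; apply: is_cutting_consistent cutK.
by case: pselect => calpha; split=> // _; apply: is_cutting_set1.
Qed.

Lemma explains_explanations (R : satisfaction_system) (T : set (Sen R))
    (C : Sen R -> set (set (Mod R))) (phi psi : Sen R) :
  is_cutting T phi (C phi) -> explains T C phi psi -> explanations T phi psi.
Proof.
move=> cutC [cpsi [A [[CA _] psiA]]]; split=> // m /psiA.
by move=> /(cutting_sub cutC CA)/models_add_sentence[].
Qed.

Theorem theorem2 (R : satisfaction_system) (T : set (Sen R))
    (HT : knowledge_base T) (C : Sen R -> set (set (Mod R)))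
    (HC : set_of_cuttings T C) (phi phi' psi psi' : Sen R) :
  ((forall alpha alpha' : Sen R,
      equiv_mod T alpha alpha' -> C alpha = C alpha') ->
   equiv_mod T phi phi' -> equiv_mod T psi psi' ->
   explains T C phi psi -> explains T C phi' psi')
  /\
  (explains T C phi psi ->
   entails (add_sentence T psi') psi -> consistent_with T psi' ->
   explains T C phi psi')
  /\
  (consistent_with T phi ->
   (explanations T phi psi <->
    exists C' : Sen R -> set (set (Mod R)),
      set_of_cuttings T C' /\ explains T C' phi psi))
  /\
  (finitely_axiomatizable R -> has_conjunction R ->
   forall K : set (set (Mod R)), is_cutting T phi K ->
     explanations T phi !=set0 /\
     exists (chi : Sen R) (C' : Sen R -> set (set (Mod R))),
       set_of_cuttings T C' /\ C' phi = K /\ explains T C' phi chi).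
Proof.
split; [|split; [|split]].
(* [explains] depends on [phi] only through [C phi] and on [psi] only through its models over
   [T]. *)
- move=> CE phiE psiE; rewrite /explains /consistent_with -(CE _ _ phiE).
  by rewrite /consistent -psiE.
- move=> [cpsi [A [minA psiA]]] psi'psi cpsi'; split=> //; exists A; split=> //.
  move=> m mpsi'; apply: psiA; apply/models_add_sentence; split.
    by case/models_add_sentence: mpsi'.
  exact: psi'psi.
- move=> cphi; split=> [[cpsi psiphi]|[C' [cutC' C'psi]]]; last first.
    by apply: explains_explanations C'psi; apply: (cutC' phi).1.
  (* With this cutting the only minimal class is all of Mod(T + phi), so lying below it is just
     entailing [phi]. *)
  have [C' [cutC' C'phi]] := set_of_cuttings_extend _ _ _ _
    (is_cutting_set1 _ _ _ cphi).
  exists C'; split=> //; split=> //; exists (models (add_sentence T phi)).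
  rewrite C'phi; split=> [|m mpsi]; first by split=> [|B ->].
  apply/models_add_sentence; split; last exact: psiphi.
  by case/models_add_sentence: mpsi.
- move=> finax conj K cutK.
  have [A minA] := cutting_wf cutK (fun _ KA => KA)
    (ex_intro _ _ (cutting_top cutK)).
  have [U [finU UA]] := finax A.
  have [chi chiE] := models_conjunction _ U phi conj finU.
  have [C' [cutC' C'phi]] := set_of_cuttings_extend _ _ _ _ cutK.
  (* [A] lies inside Mod(T + phi), so imposing [T] and [phi] besides [U] removes no model of [A]. *)
  have chiA : models (add_sentence T chi) = A.
    apply/seteqP; split=> m.
      move=> /models_add_sentence[_ /models_set1].
      by rewrite chiE => /models_add_sentence[]; rewrite UA.
    move=> Am; have /models_add_sentence[mT mphi] := cutting_sub cutK minA.1 Am.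
    apply/models_add_sentence; split=> //; apply/models_set1.
    by rewrite chiE; apply/models_add_sentence; rewrite UA.
  have C'chi : explains T C' phi chi.
    split; last by exists A; rewrite C'phi chiA; split=> // m.
    (* [chi] is consistent with [T] because [A], as a member of a cutting, differs from [triv]. *)
    rewrite /consistent_with /consistent chiA => Atriv.
    by have := cutting_triv cutK minA.1; rewrite Atriv => /properxx.
  split; last by exists chi, C'.
  by exists chi; apply: explains_explanations C'chi; rewrite C'phi.
Qed.
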